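(* Let $A\in\mathbb{R}^{M\times N}$ with $M<N$ have nonzero columns and $\operatorname{rank}(A)=M$, and let $\beta>0$. For $d\in\mathbb{R}^M$ let $F_d(u)=\|Au-d\|_2^2+\beta\|u\|_0$ and $$\mathrm U_M=\{\hat u\in\mathbb{R}^N:\ \hat u\text{ is a strict (local) minimizer of }F_d\text{ with }\|\hat u\|_0=M\}.$$ Put $$\mathrm Q_M=\bigcup_{\omega\in\Omega_M}\ \bigcup_{i=1}^{M}\left\{g\in\mathbb{R}^M:\ \langle e_i,A_\omega^{-1}g\rangle=0\right\}.$$ Then $\mathbb{R}^M\setminus\mathrm Q_M$ contains a dense open subset of $\mathbb{R}^M$, and $$d\in\mathbb{R}^M\setminus\mathrm Q_M\quad\Rightarrow\quad\#\mathrm U_M=\#\Omega_M\ \text{ and }\ F_d(\hat u)=\beta M\ \text{ for all }\hat u\in\mathrm U_M.$$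
   Context: $\|u\|_0$ is the number of nonzero entries of $u$; $e_i$ is the $i$th vector of the canonical basis of $\mathbb{R}^M$; $\#$ denotes cardinality. A point $\hat u$ is a strict (local) minimizer of $F_d$ if there is a neighborhood $O$ of $\hat u$ with $F_d(\hat u)<F_d(v)$ for all $v\in O\setminus\{\hat u\}$. For $\omega\subseteq\{1,\dots,N\}$, $A_\omega$ is the submatrix of $A$ formed by the columns indexed by $\omega$ (in increasing order), and $\Omega_M=\{\omega\subset\{1,\dots,N\}:\#\omega=M=\operatorname{rank}(A_\omega)\}$; for $\omega\in\Omega_M$, $A_\omega^{-1}=(A_\omega)^{-1}$. *)

(* Defs.v *)
From HB Require Import structures.
From mathcomp Require Import all_boot all_order all_algebra.
From mathcomp Require Import all_classical all_reals all_analysis.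
Set Implicit Arguments.
Unset Strict Implicit.
Unset Printing Implicit Defensive.
Import Order.TTheory GRing.Theory Num.Theory.
Import numFieldNormedType.Exports.

Local Open Scope classical_set_scope.
Local Open Scope ring_scope.

Definition dotv (R : realType) (n : nat) (x y : 'cV[R]_n) : R :=
  \sum_(i < n) x i 0 * y i 0.

(* The library norm on matrices is the sup norm, hence this definition. *)
Definition norm2 (R : realType) (n : nat) (x : 'cV[R]_n) : R :=
  Num.sqrt (\sum_(i < n) x i 0 ^+ 2).

Definition norm0 (R : realType) (n : nat) (x : 'cV[R]_n) : nat :=
  #|[set i : 'I_n | x i 0 != 0]%SET|.

Definition Fd (R : realType) (M N : nat) (A : 'M[R]_(M, N)) (beta : R)
    (d : 'cV[R]_M) (u : 'cV[R]_N) : R :=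
  norm2 (A *m u - d) ^+ 2 + beta * (norm0 u)%:R.

Definition strict_minimizer (R : realType) (n : nat) (f : 'cV[R]_n -> R)
    (u : 'cV[R]_n) : Prop :=
  exists2 O : set 'cV[R]_n, nbhs u O & forall v, (O `\ u) v -> f u < f v.

(* enum_val lists the elements of w in increasing order. *)
Definition subcols (R : realType) (M N : nat) (A : 'M[R]_(M, N))
    (w : {set 'I_N}) : 'M[R]_(M, #|w|) :=
  colsub (fun k : 'I_#|w| => enum_val k) A.

Definition OmegaM (R : realType) (M N : nat) (A : 'M[R]_(M, N)) :
    {set {set 'I_N}} :=
  [set w : {set 'I_N} | (#|w| == M) && (\rank (subcols A w) == M)]%SET.

(* conform_mx retypes subcols A w as a square matrix when #|w| = M, see
   conform_subcols; its default value 0 is irrelevant on OmegaM A. *)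
Definition subinv (R : realType) (M N : nat) (A : 'M[R]_(M, N))
    (w : {set 'I_N}) : 'M[R]_M :=
  invmx (conform_mx (0 : 'M[R]_M) (subcols A w)).

Lemma conform_subcols (R : realType) (M N : nat) (A : 'M[R]_(M, N))
    (w : {set 'I_N}) (hw : #|w| = M) :
  conform_mx (0 : 'M[R]_M) (subcols A w) =
  castmx (erefl M, hw) (subcols A w).
Proof.
by move: (subcols A w); case: M / hw {A} => B; rewrite conform_mx_id castmx_id.
Qed.

Definition QM (R : realType) (M N : nat) (A : 'M[R]_(M, N)) : set 'cV[R]_M :=
  \bigcup_(w in [set` OmegaM A]) \bigcup_(i in [set: 'I_M])
    [set g : 'cV[R]_M | dotv (delta_mx i 0) (subinv A w *m g) = 0].

Definition UM (R : realType) (M N : nat) (A : 'M[R]_(M, N)) (beta : R)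
    (d : 'cV[R]_M) : set 'cV[R]_N :=
  [set u | strict_minimizer (Fd A beta d) u /\ norm0 u = M].

(* Main.v *)
(* A strict minimizer u with M nonzero entries admits no nonzero direction h
   supported in supp u with A h = c (d - A u), c in [0, 1]: moving along h neither
   adds nonzero entries nor increases the residual. With c = 0 this makes A_w
   injective for w = supp u, hence invertible; with c = 1 it then gives A u = d.
   So u is determined by its support w, which lies in Omega_M. Conversely the
   solution of A_w x = d padded by zeros has support exactly w when d avoids Q_M,
   and it is a strict minimizer, because nearby points have support containing w:
   either the support grows, and the penalty jumps by beta, or it stays equal to
   w, and the residual becomes positive. *)
Require Import Defs.
From HB Require Import structures.
From mathcomp Require Import all_boot all_order all_algebra.
From mathcomp Require Import all_classical all_reals all_analysis.
From mathcomp Require Import finmap lra.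
Import Order.TTheory GRing.Theory Num.Theory.
Import numFieldNormedType.Exports.
Local Open Scope classical_set_scope.
Local Open Scope ring_scope.

(** * Avoiding finitely many hyperplanes *)

Lemma nbhs_ray {R : realType} {n} {u : 'cV[R]_n} (h : 'cV[R]_n)
    {O : set 'cV[R]_n} :
  nbhs u O ->
  exists2 e : R, 0 < e & forall t, 0 < t -> t < e -> O (u + t *: h).
Proof.
move=> uO; have : (fun t : R => u + t *: h) @ (0 : R) --> u + (0 : R) *: h.
  by apply: cvgD; [exact: cvg_cst|exact: scalel_continuous].
rewrite scale0r addr0 => /(_ _ uO) /= /nbhs_ballP[e e0 eO].
exists e => // t t0 te; apply: eO; rewrite /ball /= sub0r normrN.
by rewrite gtr0_norm.
Qed.

(** Openness is continuity of a linear form. For density, the form is affine in [t] along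
    [g + t *: r^T], with slope the squared length of [r], so it vanishes for at most one [t]. *)
Lemma open_dense_avoid_hyperplane {R : realType} {n} {r : 'rV[R]_n} : r != 0 ->
  open [set g : 'cV[R]_n | (r *m g) 0 0 != 0] /\
  dense [set g : 'cV[R]_n | (r *m g) 0 0 != 0].
Proof.
move=> r0; split.
  have -> : [set g : 'cV[R]_n | (r *m g) 0 0 != 0] =
      (fun g : 'cV[R]_n => \sum_k r 0 k * g k 0) @^-1` [set~ 0].
    apply/seteqP; split=> g /=; rewrite mxE => g0; first exact/eqP.
    by apply/eqP.
  apply: open_comp; last first.
    rewrite openC; apply: accessible_closed_set1.
    by apply: hausdorff_accessible; exact: norm_hausdorff.
  move=> g _; have gF : Filter (nbhs g) by exact: nbhs_filter.
  apply: (cvg_big _ gF) => [|k _]; first exact: add_continuous.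
  apply: cvgM; [exact: cvg_cst|exact: coord_continuous].
move=> O [g Og] oO.
have [e e0 eO] := nbhs_ray r^T (open_nbhs_nbhs (conj oO Og)).
have rr0 : (r *m r^T) 0 0 != 0.
  rewrite mxE; apply: contraNneq r0 => r0; apply/eqP/rowP => k; rewrite mxE.
  apply/eqP; rewrite -sqrf_eq0 expr2.
  have /psumr_eq0P : forall k, true -> 0 <= r 0 k * r^T k 0.
    by move=> j _; rewrite mxE -expr2 sqr_ge0.
  by move=> /(_ r0 k isT); rewrite mxE => ->.
have val t : (r *m (g + t *: r^T)) 0 0 = (r *m g) 0 0 + t * (r *m r^T) 0 0.
  by rewrite mulmxDr -scalemxAr !mxE.
(* Two parameters suffice: the form cannot vanish at both [e / 2] and [e / 4]. *)
have [g2|g2] := eqVneq ((r *m (g + (e / 2) *: r^T)) 0 0) 0; last first.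
  by exists (g + (e / 2) *: r^T); split=> //; apply: eO; lra.
exists (g + (e / 4) *: r^T); split; first by apply: eO; lra.
apply/negP => /eqP; move: g2; rewrite !val => g2 g4.
have /eqP : (e / 4) * (r *m r^T) 0 0 = 0 by lra.
by rewrite mulf_eq0 (negPf rr0) orbF; apply/negP; lra.
Qed.

(** Intersecting a dense open set with a dense set leaves a dense set, so the induction carries
    openness along with density. *)
Lemma open_dense_avoid_hyperplanes {R : realType} {n} {s : seq 'rV[R]_n} :
  all (fun r => r != 0) s ->
  let O := [set g : 'cV[R]_n | all (fun r => (r *m g) 0 0 != 0) s] in
  open O /\ dense O.
Proof.
elim: s => [_|r s IHs /= /andP[r0 /IHs[oO dO]]] /=.
  have -> : [set g : 'cV[R]_n | true] = setT by apply/seteqP.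
  by split; [exact: openT|move=> O O0 _; rewrite setIT].
have -> : [set g : 'cV[R]_n |
      ((r *m g) 0 0 != 0) && all (fun r => (r *m g) 0 0 != 0) s] =
    [set g | (r *m g) 0 0 != 0] `&`
    [set g | all (fun r => (r *m g) 0 0 != 0) s].
  by apply/seteqP; split=> g /= /andP.
have [oH dH] := open_dense_avoid_hyperplane r0.
by split; [exact: openI|exact: denseI].
Qed.

(** * Norm, support and padding by zeros *)

Lemma norm2_ge0 (R : realType) n (x : 'cV[R]_n) : 0 <= norm2 x.
Proof. exact: sqrtr_ge0. Qed.

Lemma norm2Z (R : realType) n (a : R) (x : 'cV[R]_n) :
  norm2 (a *: x) = `|a| * norm2 x.
Proof.
rewrite /norm2 -sqrtr_sqr -sqrtrM ?sqr_ge0// mulr_sumr; congr Num.sqrt.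
by apply: eq_bigr => i _; rewrite mxE exprMn.
Qed.

Lemma norm2_eq0 (R : realType) n (x : 'cV[R]_n) : (norm2 x == 0) = (x == 0).
Proof.
apply/eqP/eqP => [|->]; last first.
  by rewrite -[0](scale0r 0) norm2Z normr0 mul0r.
move/eqP; rewrite sqrtr_eq0 => x0; apply/colP => i; rewrite mxE.
apply/eqP; rewrite -sqrf_eq0; apply/eqP.
have sq0 j : true -> 0 <= x j 0 ^+ 2 by rewrite sqr_ge0.
apply: (psumr_eq0P sq0) => //.
by apply/eqP; rewrite eq_le x0 sumr_ge0.
Qed.

Definition supp {R : realType} {n} (u : 'cV[R]_n) : {set 'I_n} :=
  [set i | u i 0 != 0]%SET.

(** Each nonzero coordinate stays nonzero nearby by continuity, and there are only finitely many
    coordinates. *)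
Lemma supp_near (R : realType) n (u : 'cV[R]_n) :
  \forall v \near u, supp u \subset supp v.
Proof.
have uF : Filter (nbhs u) by exact: nbhs_filter.
have near_i (i : 'I_n) :
    nbhs u [set v : 'cV[R]_n | u i 0 != 0 -> v i 0 != 0].
  have [u0|u0] := eqVneq (u i 0) 0.
    by apply: filterS filterT.
  have ui : (fun v : 'cV[R]_n => v i 0) @ nbhs u --> u i 0.
    exact: coord_continuous.
  by apply: filterS (cvgr_neq0 _ ui u0) => v v0 _.
have := filter_forall uF near_i.
apply: filterS => v uv; apply/fintype.subsetP => i; rewrite !inE; exact: uv.
Qed.

(** Extension by zero along [f], encoded as a product with selected columns of the identity so that
    [A *m pad f x] reduces to [colsub f A *m x] by associativity. *)
Definition pad {R : realType} {m n} (f : 'I_m -> 'I_n) (x : 'cV[R]_m) :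
  'cV[R]_n := colsub f 1%:M *m x.

Lemma padE {R : realType} {m n} (f : 'I_m -> 'I_n) (x : 'cV[R]_m) k :
  injective f -> pad f x (f k) 0 = x k 0.
Proof.
move=> f_inj; rewrite mxE (bigD1 k)//= !mxE eqxx mul1r big1 ?addr0// => j jk.
by rewrite !mxE inj_eq// eq_sym (negPf jk) mul0r.
Qed.

Lemma pad_out (R : realType) m n (f : 'I_m -> 'I_n) (x : 'cV[R]_m) j :
  j \notin codom f -> pad f x j 0 = 0.
Proof.
move=> jf; rewrite mxE big1// => k _; rewrite !mxE.
by case: eqP => [jE|]; [rewrite jE codom_f in jf|rewrite mul0r].
Qed.

Lemma pad_rowsub {R : realType} {m n} (f : 'I_m -> 'I_n) (u : 'cV[R]_n) :
  injective f -> supp u \subset codom f -> u = pad f (rowsub f u).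
Proof.
move=> f_inj uf; apply/colP => j.
have [/codomP[k ->]|jf] := boolP (j \in codom f).
  by rewrite padE// !mxE.
rewrite pad_out//; apply: contraNeq jf => uj; apply: (fintype.subsetP uf).
by rewrite inE.
Qed.

Lemma mulmx_pad (R : realType) m n p (A : 'M[R]_(p, n)) (f : 'I_m -> 'I_n) x :
  A *m pad f x = colsub f A *m x.
Proof. by rewrite mulmxA mulmx_colsub mulmx1. Qed.

Lemma supp_pad_sub (R : realType) m n (f : 'I_m -> 'I_n) (x : 'cV[R]_m) :
  supp (pad f x) \subset codom f.
Proof.
apply/fintype.subsetP => j; rewrite inE; apply: contraNT => jf.
by rewrite pad_out.
Qed.

(** * Strict minimizers and invertible column selections *)

Lemma strict_minimizer_dir {R : realType} {M N} {A : 'M[R]_(M, N)} {beta : R}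
    {d : 'cV[R]_M} {u h : 'cV[R]_N} (c : R) :
  0 <= beta -> strict_minimizer (Fd A beta d) u -> supp h \subset supp u ->
  0 <= c <= 1 -> A *m h = c *: (d - A *m u) -> h = 0.
Proof.
move=> beta0 [V uV minu] hu /andP[c0 c1] Ah; apply/eqP; apply: contraT => h0.
have [e e0 eV] := nbhs_ray h uV.
(* The bound [e / 2] keeps the point in [V]; the bound 1 keeps the residual factor [1 - t * c] in
   [0, 1]. *)
pose t := Num.min (e / 2) 1.
have [t0 te t1] : [/\ 0 < t, t < e & t <= 1].
  rewrite lt_min gt_min ge_min lexx ltr01 orbT.
  by split=> //; [lra|apply/orP; left; lra].
have : Fd A beta d u < Fd A beta d (u + t *: h).
  apply: minu; split; first exact: eV.
  move=> /= /eqP; rewrite addrC -subr_eq0 addrK scaler_eq0 (negPf h0) orbF.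
  by apply/negP; lra.
suff : Fd A beta d (u + t *: h) <= Fd A beta d u.
  by move=> /le_lt_trans/[apply]; rewrite ltxx.
rewrite /Fd; have -> : A *m (u + t *: h) - d = (1 - t * c) *: (A *m u - d).
  rewrite mulmxDr -scalemxAr Ah scalerA scalerBl scale1r -(opprB _ d) scalerN.
  by rewrite addrAC.
have res : norm2 ((1 - t * c) *: (A *m u - d)) ^+ 2 <= norm2 (A *m u - d) ^+ 2.
  rewrite norm2Z exprMn real_normK ?num_real// ler_piMl ?sqr_ge0//.
  by rewrite expr_le1//; nra.
apply: lerD => //; apply: ler_wpM2l => //; rewrite ler_nat subset_leq_card//.
apply/fintype.subsetP => i; rewrite !inE !mxE; apply: contraNneq => u0.
have : i \notin supp h.
  by apply: contraNN (fintype.subsetP hu i) _; rewrite inE u0 eqxx.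
by rewrite inE negbK => /eqP ->; rewrite u0 mulr0 addr0.
Qed.

(** Reindexing [w] by ['I_M] confines the casts to this proof: later arguments work with the square
    matrix [colsub f A]. *)
Lemma subcols_enum (R : realType) {M N} {w : {set 'I_N}} : #|w| = M ->
  exists f : 'I_M -> 'I_N, [/\ injective f, codom f =i w &
    forall A : 'M[R]_(M, N),
      conform_mx (0 : 'M[R]_M) (subcols A w) = colsub f A].
Proof.
move=> hw; exists (fun k => enum_val (cast_ord (esym hw) k)); split.
- by move=> j k /enum_val_inj/cast_ord_inj.
- move=> j; apply/codomP/idP => [[k ->]|jw]; first exact: enum_valP.
  by exists (cast_ord hw (enum_rank_in jw j)); rewrite cast_ordK enum_rankK_in.
- move=> A; rewrite (conform_subcols A hw); apply/matrixP => i k.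
  by rewrite castmxE !mxE cast_ord_id.
Qed.

Lemma OmegaM_unitmx (R : realType) M N (A : 'M[R]_(M, N)) (w : {set 'I_N}) :
  #|w| = M ->
  (w \in OmegaM A) = (conform_mx (0 : 'M[R]_M) (subcols A w) \in unitmx).
Proof.
move=> hw; rewrite inE (introT eqP hw) (conform_subcols A hw) -row_free_unit.
rewrite /row_free /=.
by move: (subcols A w); case: _ / hw => B; rewrite castmx_id.
Qed.

Lemma strict_minimizer_supp {R : realType} {M N} {A : 'M[R]_(M, N)} {beta : R}
    {d : 'cV[R]_M} {u : 'cV[R]_N} :
  0 <= beta -> UM A beta d u -> supp u \in OmegaM A /\ A *m u = d.
Proof.
move=> beta0 [minu card_u].
have [f [f_inj fu conf]] := subcols_enum R (w := supp u) card_u.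
have no_dir c x : 0 <= c <= 1 ->
    colsub f A *m x = c *: (d - A *m u) -> x = 0.
  move=> c01; rewrite -mulmx_pad => /(strict_minimizer_dir _ beta0 minu _ c01).
  rewrite -(eq_subset_r fu) supp_pad_sub => /(_ isT) x0.
  by apply/colP => k; rewrite -(padE f)// x0 !mxE.
(* A singular matrix would have a nonzero kernel vector, which [no_dir] excludes with [c = 0]. *)
have unitB : colsub f A \in unitmx.
  rewrite unitmxE unitfE -det_tr; apply/det0P => -[v v0 vB].
  have vT0 : v^T = 0.
    apply: (no_dir 0); first by lra.
    by rewrite scale0r -[LHS]trmxK trmx_mul trmxK vB trmx0.
  by rewrite -trmx_eq0 vT0 eqxx in v0.
split; first by rewrite OmegaM_unitmx// conf.
apply/esym/eqP; rewrite -subr_eq0.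
(* With [c = 1], the preimage of the residual [d - A *m u] under [colsub f A] is an excluded
   direction, hence zero. *)
rewrite -(mulKVmx unitB (d - A *m u)) (no_dir 1 (invmx _ *m _)) ?mulmx0//.
  by lra.
by rewrite mulKVmx// scale1r.
Qed.

Lemma mulmx_supp_inj {R : realType} {M N} {A : 'M[R]_(M, N)} {w : {set 'I_N}}
    {u v : 'cV[R]_N} :
  w \in OmegaM A -> supp u \subset w -> supp v \subset w ->
  A *m u = A *m v -> u = v.
Proof.
move=> wA uw vw; have /eqP hw : #|w| == M by move: wA; rewrite inE => /andP[].
have [f [f_inj fw conf]] := subcols_enum R hw.
rewrite (pad_rowsub f u)// ?(eq_subset_r fw)//.
rewrite (pad_rowsub f v)// ?(eq_subset_r fw)//.
rewrite !mulmx_pad => /(can_inj (mulKmx _)) ->//.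
by rewrite -conf -OmegaM_unitmx.
Qed.

Lemma notin_QM (R : realType) M N (A : 'M[R]_(M, N)) (d : 'cV[R]_M) :
  (~` QM A) d <-> forall w i, w \in OmegaM A -> (subinv A w *m d) i 0 != 0.
Proof.
have dotE (x : 'cV[R]_M) i : dotv (delta_mx i 0) x = x i 0.
  rewrite /dotv (bigD1 i)//= mxE !eqxx mul1r big1 ?addr0// => j ji.
  by rewrite mxE (negPf ji) mul0r.
split=> [nQ w i wA|nz [w wA [i _]]].
  by apply/eqP => z; apply: nQ; exists w => //; exists i => //=; rewrite dotE.
by rewrite /= dotE; apply/eqP/nz.
Qed.

Lemma strict_minimizer_exact_fit (R : realType) M N (A : 'M[R]_(M, N))
    (beta : R) (d : 'cV[R]_M) (u : 'cV[R]_N) :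
  0 < beta -> supp u \in OmegaM A -> A *m u = d ->
  strict_minimizer (Fd A beta d) u.
Proof.
move=> beta0 uA Au; exists [set v | supp u \subset supp v].
  exact: supp_near.
move=> v [/= uv /eqP v_neq_u].
have n0 : norm2 (0 : 'cV[R]_M) = 0 by apply/eqP; rewrite norm2_eq0.
rewrite /Fd Au subrr n0 expr0n add0r.
have [/eqP uvE|uvE] := boolP (supp u == supp v).
  rewrite {1}/norm0 -/(supp u) uvE ltr_pwDl// exprn_gt0// lt_neqAle norm2_ge0.
  (* With equal supports the penalties agree, and a zero residual at [v] would give [v = u] by
     injectivity on [supp u]. *)
  rewrite andbT eq_sym norm2_eq0 subr_eq0 -Au; apply: contra v_neq_u => /eqP Av.
  by apply/eqP/(mulmx_supp_inj uA) => //; rewrite uvE.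
apply: ltr_wpDl; first exact: sqr_ge0.
by rewrite ltr_pM2l// ltr_nat proper_card// finset.properEneq uvE.
Qed.

(** * Counting the minimizers *)

Lemma card_eq_setE {T : finType} (W : {set T}) : ([set` W] #= `I_#|W|)%card.
Proof.
have -> : [set` W] = [set` [fset x in W]%fset].
  by apply/seteqP; split=> x /=; rewrite !inE.
by apply/card_eq_fsetP; rewrite card_imfset//= -cardE.
Qed.

Theorem proposition3p9 (R : realType) (M N : nat) (A : 'M[R]_(M, N)) (beta : R)
    (ltMN : (M < N)%N)
    (col_neq0 : forall j : 'I_N, col j A != 0)
    (rankA : \rank A = M)
    (beta_gt0 : 0 < beta) :
  (exists O : set 'cV[R]_M, [/\ open O, dense O & O `<=` ~` QM A]) /\
  (forall d : 'cV[R]_M, (~` QM A) d ->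
     (UM A beta d #= `I_#|OmegaM A|)%card /\
     (forall u : 'cV[R]_N, UM A beta d u -> Fd A beta d u = beta * M%:R)).
Proof.
have beta_ge0 := ltW beta_gt0.
split.
  (* The normals of the finitely many hyperplanes forming [QM A]; each is a row of an invertible
     matrix, hence nonzero. *)
  pose s := [seq row p.2 (subinv A p.1)
    | p <- enum [pred p : {set 'I_N} * 'I_M | p.1 \in OmegaM A]].
  have s0 : all (fun r => r != 0) s.
    apply/allP => r /mapP[[w i]]; rewrite mem_enum inE /= => wA ->.
    have /eqP hw : #|w| == M by move: wA; rewrite inE => /andP[].
    have := wA; rewrite OmegaM_unitmx// -unitmx_inv -row_free_unit.
    move=> /row_freeP[B VB]; apply/eqP => r0.
    have : row i (subinv A w *m B) 0 i = 0 by rewrite row_mul r0 mul0mx mxE.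
    by rewrite VB !mxE eqxx => /eqP; rewrite oner_eq0.
  have [oO dO] := open_dense_avoid_hyperplanes s0.
  exists [set g | all (fun r => (r *m g) 0 0 != 0) s]; split=> //.
  move=> g /= /allP sg; apply/notin_QM => w i wA.
  have := sg (row i (subinv A w)); rewrite -row_mul mxE; apply.
  by apply/mapP; exists (w, i); rewrite ?mem_enum.
move=> d /notin_QM dQ; split; last first.
  move=> u uU; have [_ Au] := strict_minimizer_supp beta_ge0 uU.
  case: uU => _ ucard; rewrite /Fd Au subrr ucard.
  have /eqP -> : norm2 (0 : 'cV[R]_M) == 0 by rewrite norm2_eq0.
  by rewrite expr0n add0r.
apply: (card_eq_trans _ (card_eq_setE (OmegaM A))).
(* The count follows from [supp] being a bijection from [UM A beta d] onto [OmegaM A]. *)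
have -> : [set` OmegaM A] = supp @` UM A beta d.
  apply/seteqP; split=> [w /= wA|_ [u uU <-]]; last first.
    by have [] := strict_minimizer_supp beta_ge0 uU.
  have /eqP hw : #|w| == M by move: wA; rewrite inE => /andP[].
  have [f [f_inj fw conf]] := subcols_enum R hw.
  pose u := pad f (subinv A w *m d).
  have uw : supp u = w.
    apply/setP => j; rewrite inE -fw; apply/idP/codomP => [uj|[k ->]].
      by apply/codomP; apply: contraNT uj => jf; rewrite pad_out.
    (* Avoidance of [QM A] enters here: no entry of the solution vanishes, so its support is all of
       [w]. *)
    by rewrite padE// dQ.
  have Au : A *m u = d.
    by rewrite mulmx_pad -conf mulKVmx// -OmegaM_unitmx.
  exists u => //; split; last by rewrite /norm0 -/(supp u) uw.
  by apply: strict_minimizer_exact_fit => //; rewrite uw.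
(* Two minimizers with the same support both solve [A *m u = d], so they coincide. *)
rewrite card_eq_sym; apply: inj_card_eq => u v /set_mem uU /set_mem vU uv.
have [uA Au] := strict_minimizer_supp beta_ge0 uU.
have [_ Av] := strict_minimizer_supp beta_ge0 vU.
by apply: (mulmx_supp_inj uA); rewrite ?uv// Au Av.
Qed.
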